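(* Let $k$ be a field, let $n \ge 1$, and let $k(x) = k(x_1,\ldots,x_n)$ be the field of rational functions over $k$ in the $n$ indeterminates $x_1,\ldots,x_n$. Let $\mathcal{K}$ be a field with $k \subseteq \mathcal{K} \subseteq k(x)$ and such that $\mathcal{K}$ has transcendence degree $1$ over $k$. Then there exists $v \in k(x)$ such that $\mathcal{K} = k(v)$.
   Context: Here $k$ is an arbitrary field (no assumption on its characteristic or algebraic closedness), and $\mathcal{K}$ is an intermediate field of the extension $k(x_1,\ldots,x_n)/k$. $k(v)$ denotes the subfield of $k(x)$ generated by $k$ and $v$. *)

(* Defs.v *)
From HB Require Import structures.
From mathcomp Require Import all_boot all_order all_algebra.
From mathcomp Require Import mpoly.
From mathcomp Require Import boolp classical_sets.

Set Implicit Arguments.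
Unset Strict Implicit.
Unset Printing Implicit Defensive.

Import GRing.Theory.

Local Open Scope ring_scope.
Local Open Scope classical_set_scope.

(* A field extension L / k is given by a ring morphism iota : k -> L, and its
   intermediate fields are arbitrary (not necessarily decidable) subsets of L. *)
Section Extension.
Variables (k L : fieldType) (iota : {rmorphism k -> L}).

Definition intermediate_field (K : set L) : Prop :=
  range iota `<=` K /\ GRing.divring_closed (mem K).

Definition adjoin (S : set L) : set L := smallest intermediate_field S.

(* Algebraic over the subfield F of L. *)
Definition algebraic_over (F : set L) (y : L) : Prop :=
  exists p : {poly L}, [/\ p != 0, p \is a polyOver (mem F) & root p y].

Definition alg_independent (d : nat) (t : 'I_d -> L) : Prop :=
  forall p : {mpoly k[d]}, mmap iota t p = 0 -> p = 0.

Definition transcendence_basis (K : set L) (d : nat) (t : 'I_d -> L) : Prop :=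
  [/\ range t `<=` K, alg_independent t
    & K `<=` algebraic_over (adjoin (range t))].

Definition has_trdeg (K : set L) (d : nat) : Prop :=
  exists t : 'I_d -> L, transcendence_basis K t.

End Extension.

Definition ratfun (k : fieldType) (n : nat) : fieldType :=
  {fraction {mpoly k[n]}}.

Definition ratfun_const (k : fieldType) (n : nat) : {rmorphism k -> ratfun k n} :=
  (@tofrac {mpoly k[n]} \o @mpolyC n k : k -> ratfun k n).

(* Main.v *)
Require Import Defs.
From HB Require Import structures.
From mathcomp Require Import all_boot all_order all_algebra.
From mathcomp Require Import mpoly.
From mathcomp Require Import boolp classical_sets.

(** A place of k(x_1, .., x_n) over k that sends some t in K to an element
transcendental over k is finite and injective on K, because K is algebraic
over k(t). Sending x_i to T^(N^i) with N large keeps the numerator and the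
denominator of t linearly independent over k, so that K embeds in k(T).

Inside k(T), take v = f/g in K non-constant with max(deg f, deg g) minimal.
Let Q(T, Y) be a primitive integral multiple of the minimal polynomial of T
over K. By Gauss's lemma it divides W = g(T) f(Y) - f(T) g(Y); by minimality
of v it has T-degree at least that of W, so the cofactor lies in k[Y], where
it divides f and g and hence is constant. Thus every polynomial over K
vanishing at T is a multiple of D = f - v g. For y = a/b in K, this applies
to a - y b, and reducing a and b modulo D, which has coefficients in k(v),
expresses y as a quotient of elements of k(v). *)

Set Implicit Arguments.
Unset Strict Implicit.
Unset Printing Implicit Defensive.

Import GRing.Theory.

Local Open Scope ring_scope.
Local Open Scope classical_set_scope.

(** * Ring morphisms and fields of fractions *)

Lemma ex_rmorphism (A B : nzRingType) (f : A -> B) :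
  zmod_morphism f -> monoid_morphism f ->
  exists g : {rmorphism A -> B}, g =1 f.
Proof.
move=> fB fM.
pose g : {rmorphism A -> B} := HB.pack f
  (GRing.isZmodMorphism.Build A B f fB) (GRing.isMonoidMorphism.Build A B f fM).
by exists g.
Qed.

Lemma tofrac_inj (A : idomainType) : injective (@tofrac A).
Proof. by move=> a b /eqP; rewrite tofrac_eq => /eqP. Qed.

Lemma fracP (A : idomainType) (x : {fraction A}) :
  exists a b : A, b != 0 /\ x = tofrac a / tofrac b.
Proof.
elim/quotW: x => r.
exists r.1, r.2; have d0 := denom_ratioP r; split=> //.
apply: (canRL (mulfK _)); first by rewrite tofrac_eq0.
(* Stated with the multiplication of the quotient construction, which [piE] can unfold; it is
   convertible to the ring product. *)
have: FracField.mul (\pi_{fraction A} r)%qT (tofrac r.2) = tofrac r.1.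
  rewrite !piE; apply/eqmodP.
  by rewrite /= FracField.equivfE !numden_Ratio ?oner_eq0 ?mulr1 ?mulf_neq0 // mulrC.
by [].
Qed.

(** Universal property of the field of fractions. A value is first picked through some
    representation as a quotient; [fE] shows by cross multiplication that any other representation
    gives the same. *)
Lemma frac_lift (A : idomainType) (E : fieldType) (e : {rmorphism A -> E}) :
  injective e ->
  exists e' : {rmorphism {fraction A} -> E}, forall a, e' (tofrac a) = e a.
Proof.
move=> e_inj.
have e_neq0 a : a != 0 -> e a != 0 by rewrite -(inj_eq e_inj) rmorph0.
have /choice[f fP] (x : {fraction A}) : exists y : E, exists a b : A,
    [/\ b != 0, x = tofrac a / tofrac b & y = e a / e b].
  by have [a [b [b0 ->]]] := fracP x; exists (e a / e b), a, b.
have fE a b : b != 0 -> f (tofrac a / tofrac b) = e a / e b.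
  move=> b0; have [c [d [d0 /eqP]]] := fP (tofrac a / tofrac b).
  rewrite eqr_div ?tofrac_eq0 // -!tofracM tofrac_eq => /eqP E1 ->.
  by apply/eqP; rewrite eqr_div ?e_neq0 // -!rmorphM E1 mulrC.
have fB : zmod_morphism f.
  move=> x y; have [a [b [b0 -> ->]]] := fP x; have [c [d [d0 -> ->]]] := fP y.
  rewrite -!mulNr -tofracN addf_div ?tofrac_eq0 // -!tofracM -tofracD.
  by rewrite fE ?mulf_neq0 // -rmorphN addf_div ?e_neq0 // -!rmorphM -rmorphD.
have fM : monoid_morphism f.
  split; first by rewrite -[1]divr1 -tofrac1 fE ?oner_neq0 // !rmorph1 divr1.
  move=> x y; have [a [b [b0 -> ->]]] := fP x; have [c [d [d0 -> ->]]] := fP y.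
  by rewrite !mulf_div -!tofracM fE ?mulf_neq0 // !rmorphM.
have [g gE] := ex_rmorphism fB fM; exists g => a.
by rewrite gE -[tofrac a]divr1 -tofrac1 fE ?oner_neq0 // rmorph1 divr1.
Qed.

(** * Places as relations, and specialisation of variables *)

(* [S x a] reads: the place is finite at x, with value a. *)
Record place (L M : fieldType) (S : L -> M -> Prop) : Prop := Place {
  place1 : S 1 1;
  placeB : forall x y a b, S x a -> S y b -> S (x - y) (a - b);
  placeM : forall x y a b, S x a -> S y b -> S (x * y) (a * b);
  place_fun : forall x a b, S x a -> S x b -> a = b;
  place_total : forall x, (exists a, S x a) \/ S x^-1 0
}.

Section PlaceTheory.
Variables (L M : fieldType) (S : L -> M -> Prop).
Hypothesis S_place : place S.

Lemma place0 : S 0 0.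
Proof. by have := placeB S_place (place1 S_place) (place1 S_place); rewrite !subrr. Qed.

Lemma placeD x y a b : S x a -> S y b -> S (x + y) (a + b).
Proof.
move=> Sx Sy; rewrite -[y]opprK -[b]opprK; apply: placeB => //.
by rewrite -[- y]sub0r -[- b]sub0r; apply: placeB => //; apply: place0.
Qed.

Lemma placeV x a : S x a -> a != 0 -> S x^-1 a^-1.
Proof.
move=> Sx a0; have x0 : x != 0.
  by apply: contra_neq a0 => x0; apply: (place_fun S_place Sx); rewrite x0; apply: place0.
have [[b Sb]|S0] := place_total S_place x^-1.
  have := placeM S_place Sx Sb; rewrite divff // => /(place_fun S_place (place1 S_place)).
  by move=> ab; rewrite -[a^-1]mulr1 ab mulKf.
by move: a0; rewrite invrK in S0; rewrite (place_fun S_place Sx S0) eqxx.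
Qed.

End PlaceTheory.

Lemma place_comp (L M N : fieldType) (S : L -> M -> Prop) (S' : M -> N -> Prop) :
  place S -> place S' -> place (fun x c => exists2 b, S x b & S' b c).
Proof.
move=> pS pS'; split.
- by exists 1; apply: place1.
- by move=> x y a b [x' ? ?] [y' ? ?]; exists (x' - y'); apply: placeB.
- by move=> x y a b [x' ? ?] [y' ? ?]; exists (x' * y'); apply: placeM.
- move=> x a b [x' h1 h2] [y' h3 h4].
  by rewrite (place_fun pS h3 h1) in h4; apply: (place_fun pS' h2 h4).
- move=> x; have [[m Sm]|S0] := place_total pS x; last first.
    by right; exists 0 => //; apply: place0.
  have [[c Sc]|S0] := place_total pS' m; first by left; exists c, m.
  (* Here [x] has value [m] and [S'] sends the inverse of [m] to 0; for [m] nonzero, the inverse of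
     [x] is then sent to 0. *)
  have [m0|m0] := eqVneq m 0; first by left; exists 0, m => //; rewrite m0; apply: place0.
  by right; exists m^-1 => //; apply: placeV.
Qed.

Lemma frac_poly_place (T : fieldType) (c : T) :
  exists2 S : {fraction {poly T}} -> T -> Prop, place S
    & forall p, S (tofrac p) p.[c].
Proof.
pose S (x : {fraction {poly T}}) u := exists a b : {poly T},
  [/\ b.[c] != 0, x = tofrac a / tofrac b & u = a.[c] / b.[c]].
have neq0 (b : {poly T}) : b.[c] != 0 -> b != 0.
  by apply: contra_neq => ->; rewrite horner0.
have tneq0 (b : {poly T}) : b.[c] != 0 -> tofrac b != 0.
  by rewrite tofrac_eq0; apply: neq0.
have Sp p : S (tofrac p) p.[c].
  by exists p, 1; rewrite hornerC oner_neq0 tofrac1 !divr1.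
exists S => //; split.
- by have := Sp 1; rewrite tofrac1 hornerC.
- move=> x y _ _ [a [b [b0 -> ->]]] [a' [b' [b0' -> ->]]].
  exists (a * b' - a' * b), (b * b'); rewrite !hornerE mulf_neq0 //.
  rewrite -!mulNr !addf_div ?tneq0 // !mulNr.
  by rewrite tofracB !tofracM.
- move=> x y _ _ [a [b [b0 -> ->]]] [a' [b' [b0' -> ->]]].
  by exists (a * a'), (b * b'); rewrite !hornerM mulf_neq0 // !mulf_div !tofracM.
- move=> x _ _ [a [b [b0 -> ->]]] [a' [b' [b0' /eqP + ->]]].
  rewrite eqr_div ?tneq0 // -!tofracM tofrac_eq => /eqP /(congr1 (horner^~ c)).
  by rewrite !hornerM => E; apply/eqP; rewrite eqr_div // E.
- move=> x; have [a [b [b0 ->]]] := fracP x.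
  (* An indeterminate form at [c] is resolved by cancelling ['X - c%:P] from numerator and
     denominator, which shrinks the denominator. *)
  have [n] := ubnP (size b); elim: n a b b0 => // n IHn a b b0 /ltnSE-le_n.
  have [bc|bc] := eqVneq b.[c] 0; last by left; exists (a.[c] / b.[c]), a, b.
  have [ac|ac] := eqVneq a.[c] 0; last first.
    by right; exists b, a; rewrite ac bc mul0r invf_div.
  move: bc ac => /rootP/factor_theorem[b' bE] /rootP/factor_theorem[a' aE].
  have b0' : b' != 0 by apply: contra_neq b0 => b'0; rewrite bE b'0 mul0r.
  have Xc0 := polyXsubC_eq0 c.
  rewrite aE bE !tofracM -mulf_div divff ?tofrac_eq0 ?Xc0 // mulr1.
  apply: IHn => //; apply: leq_trans le_n.
  by rewrite bE size_Mmonic ?monicXsubC // size_XsubC addn2.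
Qed.

(** [muni] moves the exponent of the last variable to the outer degree, so every coefficient of [p]
    can be read back; injectivity of [muni] follows. *)
Lemma mcoeff_muni (R : nzRingType) n (p : {mpoly R[n.+1]}) (m : 'X_{1..n.+1}) :
  ((muni p)`_(m ord_max))@_[multinom m (widen_ord (leqnSn n) i) | i < n] = p@_m.
Proof.
rewrite muniE coef_sum raddf_sum /=.
rewrite [in RHS](mpolyE p) raddf_sum /=.
apply: eq_bigr => m' _.
have eq_mm : (m' ord_max == m ord_max) && ([multinom m' (widen_ord (leqnSn n) i) | i < n]
    == [multinom m (widen_ord (leqnSn n) i) | i < n]) = (m' == m).
  apply/andP/eqP => [[/eqP e1 /eqP/mnmP e2]|-> //]; apply/mnmP => i.
  have [[j ->]|->//] : (exists j, i = widen_ord (leqnSn n) j) \/ i = ord_max.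
    case: (unliftP ord_max i) => [j ->|]; [left; exists j|by right].
    by apply/val_inj; rewrite /= /bump leqNgt ltn_ord.
  by have := e2 j; rewrite !mnmE.
rewrite coefZ coefXn eq_sym mulr_natr raddfMn /= !mcoeffZ !mcoeffX -eq_mm.
by rewrite -mulrnAr -mulnb natrM mulr_natl.
Qed.

Lemma muni_inj (R : nzRingType) n : injective (@muni n R).
Proof.
move=> p q epq; apply/mpolyP => m.
by rewrite -!mcoeff_muni epq.
Qed.

Lemma meval_muni (R : comNzRingType) n (h : 'I_n.+1 -> R) (p : {mpoly R[n.+1]}) :
  meval (fun i => h (widen_ord (leqnSn n) i)) (muni p).[(h ord_max)%:MP] = meval h p.
Proof.
rewrite muniE horner_sum raddf_sum /=.
rewrite [RHS]mevalE; apply: eq_bigr => m' _.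
rewrite hornerZ hornerXn mevalM mevalZ rmorphXn /= mevalC big_ord_recr /= mulrA.
congr (_ * _ * _); rewrite mevalX; apply: eq_bigr => i _.
by rewrite mnmE.
Qed.

(* [T] is an iterated field of rational functions, whose variables are
   specialised one at a time. *)
Lemma mpoly_place (M : fieldType) n (h : 'I_n -> M) :
  exists (T : fieldType) (e : {rmorphism {mpoly M[n]} -> T}) (S : T -> M -> Prop),
    [/\ injective e, place S & forall p, S (e p) (meval h p)].
Proof.
elim: n h => [|n IHn] h.
  exists M, (meval h), eq; split => //; last first.
    by split => // [x y _ _ -> -> //|x y _ _ -> -> //|x a b <- //|x]; left; exists x.
  have polyC0 (p : {mpoly M[0]}) : p = (mcoeff 0%MM p)%:MP.
    apply/mpolyP => m; rewrite mcoeffC (_ : m = 0%MM) ?eqxx ?mulr1 //.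
    by apply/mnmP; case.
  by move=> p q /=; rewrite [p]polyC0 [q]polyC0 !mevalC => ->.
have [T [e [S [e_inj S_place Se]]]] := IHn (fun i => h (widen_ord (leqnSn n) i)).
(* The last variable is specialised first, at a constant of [T]; the place from the induction
   hypothesis then treats the others. *)
have [S' S'_place S'e] := frac_poly_place (e (h ord_max)%:MP).
pose e' : {rmorphism {mpoly M[n.+1]} -> {fraction {poly T}}} :=
  @tofrac _ \o map_poly e \o @muni n M.
exists {fraction {poly T}}, e', (fun x c => exists2 b, S' x b & S b c).
split; last first.
- move=> p; exists (map_poly e (muni p)).[e (h ord_max)%:MP] => //=.
  by rewrite horner_map -meval_muni.
- exact: place_comp.
- move=> p q /= /eqP; rewrite tofrac_eq => /eqP /map_inj_poly; rewrite rmorph0.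
  by move=> /(_ e_inj erefl) /muni_inj.
Qed.

(** * Subfields as field types *)

Section Subfield.
Variables (L : fieldType) (S : divringClosed L).

Record subfield_type := Subfield { subfield_val :> L; _ : subfield_val \in S }.

HB.instance Definition _ := [isSub for subfield_val].
HB.instance Definition _ := [Choice of subfield_type by <:].
HB.instance Definition _ := [SubChoice_isSubIntegralDomain of subfield_type by <:].
HB.instance Definition _ := [SubIntegralDomain_isSubField of subfield_type by <:].

End Subfield.

(** Replaces a subset by a field type, over which polynomial division and morphisms are
    available. *)
Lemma divring_closed_subfield (L : fieldType) (K : {pred L}) :
  GRing.divring_closed K ->
  exists (F : fieldType) (i : {rmorphism F -> L}),
    forall y, y \in K <-> exists x, y = i x.
Proof.
move=> K_div.
pose S : divringClosed L := HB.pack K (GRing.isDivringClosed.Build L K K_div).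
exists (subfield_type S), (val : {rmorphism subfield_type S -> L}) => y.
split=> [yK|[x ->]]; last exact: (valP x).
by exists (Subfield (S := S) yK).
Qed.

Lemma sub_field_morph (k L F : fieldType) (iota : {rmorphism k -> L})
    (i : {rmorphism F -> L}) :
  (forall c, exists x, iota c = i x) ->
  exists iota' : {rmorphism k -> F}, forall c, i (iota' c) = iota c.
Proof.
move=> /choice[f fE].
have [||g gE] := @ex_rmorphism k F f.
- by move=> x y; apply: (fmorph_inj i); rewrite rmorphB -!fE rmorphB.
- split=> [|x y]; apply: (fmorph_inj i); first by rewrite -fE !rmorph1.
  by rewrite rmorphM -!fE rmorphM.
by exists g => c; rewrite gE -fE.
Qed.

(** * Places on k(x) and embeddings obtained from them *)

Lemma place_precomp (F L M : fieldType) (i : {rmorphism F -> L}) (S : L -> M -> Prop) :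
  place S -> place (fun x => S (i x)).
Proof.
move=> pS; split.
- by rewrite rmorph1; apply: place1.
- by move=> x y a b; rewrite rmorphB; apply: placeB.
- by move=> x y a b; rewrite rmorphM; apply: placeM.
- by move=> x a b; apply: (place_fun pS).
- by move=> x; rewrite fmorphV; apply: place_total.
Qed.

(** The specialisation of each x_i at [h i]. The [h i] may be algebraically dependent, so only a
    place is obtained: k(x) is embedded in the field [T] that carries a place extending evaluation
    on M[x], and this place is restricted. *)
Lemma ratfun_place (k M : fieldType) n (iota : {rmorphism k -> M}) (h : 'I_n -> M) :
  exists2 S : ratfun k n -> M -> Prop, place S
    & forall p, S (tofrac p) (mmap iota h p).
Proof.
have [T [e [S [e_inj S_place Se]]]] := mpoly_place h.
have map_inj : injective (map_mpoly (n := n) iota).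
  move=> p q epq; apply/mpolyP => m; apply: (fmorph_inj iota).
  by rewrite -!mcoeff_map_mpoly epq.
have [|E' E'E] := @frac_lift {mpoly k[n]} T (e \o map_mpoly iota).
  exact: inj_comp e_inj map_inj.
exists (fun x => S (E' x)); first exact: place_precomp.
move=> p; rewrite E'E /=; suff <- : meval h (map_mpoly iota p) = mmap iota h p by [].
rewrite mevalE (perm_big _ (msupp_map_mpoly _ (fmorph_inj iota))) /=.
by apply: eq_bigr => m _; rewrite mcoeff_map_mpoly.
Qed.

Lemma place_horner (R : nzRingType) (F M : fieldType) (S : F -> M -> Prop)
    (f : {rmorphism R -> F}) (g : {rmorphism R -> M}) (P : {poly R}) w c :
  place S -> (forall r, S (f r) (g r)) -> S w c ->
  S (map_poly f P).[w] (map_poly g P).[c].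
Proof.
move=> pS Sr Sw; elim/poly_ind: P => [|P r IH].
  by rewrite !rmorph0 !horner0; apply: place0.
rewrite !rmorphD !rmorphM /= !map_polyX !map_polyC /= !hornerE.
by apply: placeD => //; apply: placeM.
Qed.

(** If a nonzero [w] had value 0, its equation would specialise to the vanishing of the image of the
    constant coefficient of [P], against the injectivity of [g]. A pole is excluded likewise, since
    its inverse would have value 0. The place is thus an everywhere defined map. *)
Lemma place_embedding (R : nzRingType) (F M : fieldType) (S : F -> M -> Prop)
    (f : {rmorphism R -> F}) (g : {rmorphism R -> M}) :
  place S -> injective g -> (forall r, S (f r) (g r)) ->
  (forall w, w != 0 -> exists P : {poly R}, P`_0 != 0 /\ (map_poly f P).[w] = 0) ->
  exists j : {rmorphism F -> M}, forall x, S x (j x).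
Proof.
move=> pS g_inj Sr alg.
have not0 w : w != 0 -> ~ S w 0.
  move=> /alg[P [P0 Pw]] /(place_horner P pS Sr).
  rewrite Pw horner_coef0 coef_map /= => /(place_fun pS (place0 pS)) /esym/eqP.
  by rewrite -(rmorph0 g) (inj_eq g_inj) (negPf P0).
have /choice[j jS] (x : F) : exists a, S x a.
  have [->|x0] := eqVneq x 0; first by exists 0; apply: place0.
  have [//|S0] := place_total pS x; suff /not0 : x^-1 != 0 by case.
  by rewrite invr_eq0.
have [||j' j'E] := @ex_rmorphism F M j.
- by move=> x y; apply: (place_fun pS (jS _)); apply: placeB.
- by split=> [|x y]; apply: (place_fun pS (jS _)); [apply: place1|apply: placeM].
by exists j' => x; rewrite j'E.
Qed.

(** * Kronecker substitution *)

Lemma weight_inj N n (f g : 'I_n -> nat) :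
  (forall i, f i < N)%N -> (forall i, g i < N)%N ->
  (\sum_i f i * N ^ i = \sum_i g i * N ^ i)%N -> f =1 g.
Proof.
elim: n f g => [|n IHn] f g fN gN; first by move=> _ [].
have N0 : (0 < N)%N by apply: leq_ltn_trans (fN ord0).
have shift (u : 'I_n.+1 -> nat) : (\sum_i u i * N ^ i =
    (\sum_(i < n) u (lift ord0 i) * N ^ i) * N + u ord0)%N.
  rewrite big_ord_recl muln1 big_distrl addnC; congr (_ + _)%N.
  by apply: eq_bigr => i _; rewrite lift0 expnSr mulnA.
rewrite !shift => E.
have E0 : f ord0 = g ord0.
  by have := congr1 (modn^~ N) E; rewrite !modnMDl !modn_small.
move/eqP: E; rewrite E0 eqn_add2r eqn_pmul2r // => /eqP /IHn E i.
case: (unliftP ord0 i) => [j ->|->//].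
by apply: E => ?.
Qed.

(** Every exponent occurring in [p] is a base [N] digit, so distinct monomials go to distinct powers
    of ['X] and nothing cancels. *)
Lemma kronecker_inj (k : fieldType) n N (p : {mpoly k[n]}) :
  (msize p <= N)%N -> mmap polyC (fun i : 'I_n => 'X^(N ^ i)) p = 0 -> p = 0.
Proof.
move=> pN p0; apply/mpolyP => m; rewrite mcoeff0; apply/eqP.
case: (boolP (m \in msupp p)) => [mp|]; last by rewrite mcoeff_eq0.
have small m' i : m' \in msupp p -> (m' i < N)%N.
  (* For a nonzero polynomial [msize] is one more than the total degree, whence the strict bound. *)
  move=> /msize_mdeg_lt lt; apply: leq_trans pN; apply: leq_ltn_trans lt.
  by rewrite mdegE (bigD1 i) //= leq_addr.
pose w (m' : 'X_{1..n}) := (\sum_i m' i * N ^ i)%N.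
have mmap1E m' : mmap1 (fun i : 'I_n => 'X^(N ^ i)) m' = 'X^(w m') :> {poly k}.
  by rewrite /w expr_sum; apply: eq_bigr => i _; rewrite mulnC exprM.
move/(congr1 (fun q : {poly k} => q`_(w m))): p0.
rewrite coef0 /mmap coef_sum (bigD1_seq m) //= big1_seq => [|m' /andP[m'm m'p]].
  by rewrite addr0 coefCM mmap1E coefXn eqxx mulr1 => ->.
rewrite coefCM mmap1E coefXn; case: eqP => [E|_]; last by rewrite mulr0.
case/eqP: m'm; apply/esym/mnmP => i.
by apply: (weight_inj _ _ E) => j; exact: small.
Qed.

(** * The field k(T), and the embedding of K into it *)

Lemma frac_coprime (k : fieldType) (x : {fraction {poly k}}) :
  exists a b : {poly k}, [/\ b != 0, coprimep a b & x = tofrac a / tofrac b].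
Proof.
have [a [b [b0 ->]]] := fracP x.
have g0 : gcdp a b != 0 by rewrite gcdp_eq0 (negPf b0) andbF.
have aE := divpK (dvdp_gcdl a b); have bE := divpK (dvdp_gcdr a b).
have b0' : b %/ gcdp a b != 0 by apply: contra_neq b0 => E; rewrite -bE E mul0r.
exists (a %/ gcdp a b), (b %/ gcdp a b); split=> //.
  by rewrite coprimep_div_gcd // b0 orbT.
apply/eqP; rewrite eqr_div ?tofrac_eq0 // -!tofracM tofrac_eq.
have cross (a' b' g : {poly k}) : a' * g = a -> b' * g = b -> a * b' = a' * b.
  by move=> <- <-; rewrite mulrAC mulrA.
by rewrite (cross _ _ _ aE bE).
Qed.

(** k is algebraically closed in k(T). As for rational roots, the denominator in lowest terms
    divides a power of the numerator, so it is a unit and [s] is a polynomial; substituting a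
    nonconstant polynomial into a nonzero [c] cannot give 0. *)
Lemma frac_poly_transc (k : fieldType) (s : {fraction {poly k}}) (c : {poly k}) :
  c != 0 -> (map_poly (@tofrac {poly k} \o polyC) c).[s] = 0 ->
  exists l : k, s = tofrac l%:P.
Proof.
move=> c0; have [a [b [b0 ab ->]]] := frac_coprime s => cs0.
have tb0 : tofrac b != 0 by rewrite tofrac_eq0.
have [d dE] : exists d, size c = d.+1.
  by exists (size c).-1; rewrite prednK // lt0n size_poly_eq0.
have hom0 : \sum_(i < d.+1) (c`_i)%:P * a ^+ i * b ^+ (d - i)%N = 0.
  apply/eqP; rewrite -tofrac_eq0 rmorph_sum /=; apply/eqP.
  transitivity (tofrac b ^+ d *
      (map_poly (@tofrac {poly k} \o polyC) c).[tofrac a / tofrac b]);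
    last by rewrite cs0 mulr0.
  rewrite horner_coef size_map_poly dE mulr_sumr; apply: eq_bigr => i _.
  rewrite coef_map /= !tofracM !tofracXn expr_div_n.
  have le_id : (i <= d)%N by rewrite -ltnS.
  rewrite -[in tofrac b ^+ d](subnK le_id) exprD mulrCA mulrACA divff ?expf_neq0 //.
  by rewrite mulr1 -mulrA [_ ^+ i * _]mulrC.
have b_a : b %| a ^+ d.
  move: hom0; rewrite big_ord_recr /= subnn expr0 mulr1 => /eqP.
  rewrite addr_eq0 => /eqP E.
  have : b %| (c`_d)%:P * a ^+ d.
    rewrite -dvdpNr -E; apply: (big_ind (fun u => b %| u)) => [|u v|i _].
    - exact: dvdp0.
    - exact: dvdp_add.
    - by rewrite dvdp_mull // dvdp_exp // subn_gt0.
  rewrite mul_polyC dvdpZr //.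
  by have := c0; rewrite -lead_coef_eq0 lead_coefE dE.
have : b %| 1.
  by rewrite -(@Gauss_dvdpr _ _ (a ^+ d)) ?mulr1 // coprimep_sym coprimep_expl.
rewrite dvdp1 => /eqP/eqP /size_poly1P [l l0 bE].
have sE : tofrac a / tofrac b = tofrac (l^-1 *: a).
  apply: (canLR (mulfK tb0)); rewrite -tofracM bE -mul_polyC mulrAC -polyCM mulVf //.
  by rewrite mul1r.
move: cs0; rewrite sE map_poly_comp horner_map -/(comp_poly _ _) => /eqP.
rewrite tofrac_eq0; case: (ltnP 1 (size (l^-1 *: a))) => [/comp_poly_eq0 ->|].
  by rewrite (negPf c0).
by move=> /size1_polyC -> _; eexists.
Qed.

(** The last hypothesis says that [F] is algebraic over k(t), with denominators cleared and a
    nonzero constant coefficient. The Kronecker place takes a transcendental value at [t], so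
    [place_embedding] applies with k[t] as base ring. *)
Lemma trdeg1_embedding (k F : fieldType) n (iota : {rmorphism k -> F})
    (i : {rmorphism F -> ratfun k n}) (t : F) :
  (forall c, i (iota c) = ratfun_const k n c) ->
  (forall c : {poly k}, c != 0 -> (map_poly iota c).[t] != 0) ->
  (forall w, w != 0 -> exists P : {poly {poly k}},
     P`_0 != 0 /\ (map_poly (fun c => (map_poly iota c).[t]) P).[w] = 0) ->
  exists j : {rmorphism F -> {fraction {poly k}}},
    forall c, j (iota c) = tofrac c%:P.
Proof.
move=> i_iota t_transc F_alg.
have [p [q [q0 tE]]] := fracP (i t).
pose N := maxn (msize p) (msize q).
pose s (r : {mpoly k[n]}) := mmap polyC (fun u : 'I_n => 'X^(N ^ u)) r.
(* [N] bounds the size of every k-combination of [p] and [q], so a relation between their images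
   comes from one between them: the denominator survives, and the value of [t] is constant only if
   [t] is. *)
have s_inj a b : s (a *: p - b *: q) = 0 -> a *: p - b *: q = 0.
  apply: kronecker_inj; rewrite -scaleNr; apply: leq_trans (msizeD_le _ _) _.
  by rewrite geq_max (leq_trans (msizeZ_le _ _)) ?leq_maxl //
             (leq_trans (msizeZ_le _ _)) ?leq_maxr.
pose cst : {rmorphism k -> {fraction {poly k}}} := @tofrac {poly k} \o polyC.
have [S S_place Sp] := ratfun_place cst (fun u : 'I_n => tofrac 'X^(N ^ u)).
have mmapE r : mmap cst (fun u : 'I_n => tofrac 'X^(N ^ u)) r = tofrac (s r).
  rewrite /s /mmap rmorph_sum; apply: eq_bigr => m _ /=.
  rewrite tofracM /mmap1 rmorph_prod; congr (_ * _).
  by apply: eq_bigr => u _; rewrite [RHS]rmorphXn.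
have sq0 : tofrac (s q) != 0.
  rewrite tofrac_eq0; apply: contra_neq q0 => sq0.
  (* The combination with coefficients 0 and -1 is [q] itself. *)
  have := @s_inj 0 (-1); rewrite scale0r sub0r scaleNr opprK scale1r; exact.
have St : S (i t) (tofrac (s p) / tofrac (s q)).
  rewrite tE; apply: (placeM S_place); first by rewrite -mmapE.
  by apply: (placeV S_place) => //; rewrite -mmapE.
have t_nconst l : t <> iota l.
  move=> tl; have := t_transc ('X - l%:P); rewrite polyXsubC_eq0 => /(_ isT).
  by rewrite rmorphB /= map_polyX map_polyC /= hornerXsubC tl subrr eqxx.
have st_nconst l : tofrac (s p) / tofrac (s q) <> tofrac l%:P.
  move=> /(canRL (mulfVK sq0)) /eqP; rewrite -tofracM tofrac_eq => /eqP E.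
  apply: (@t_nconst l); apply: (fmorph_inj i); rewrite i_iota tE /=.
  apply: (canLR (mulfK _)); first by rewrite tofrac_eq0.
  apply/eqP; rewrite -tofracM tofrac_eq -subr_eq0 mul_mpolyC -[p]scale1r.
  by apply/eqP/s_inj; rewrite scale1r /s mmapB mmapZ -!/(s _) E /= subrr.
pose f : {rmorphism {poly k} -> F} := horner_morph (fun x => mulrC t (iota x)).
pose g : {rmorphism {poly k} -> {fraction {poly k}}} :=
  horner_morph (fun x => mulrC (tofrac (s p) / tofrac (s q)) (cst x)).
have iS_place := place_precomp i S_place.
have S_cst c : S (i (iota c)) (cst c).
  by rewrite i_iota -(mmapC (fun u : 'I_n => tofrac 'X^(N ^ u)) cst); exact: Sp.
have [|||j jS] := @place_embedding _ F _ (fun x => S (i x)) f g iS_place.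
- move=> a b gab; apply/eqP; rewrite -subr_eq0; apply: contraT => ab0.
  have [|l /st_nconst//] := frac_poly_transc (s := tofrac (s p) / tofrac (s q)) ab0.
  by rewrite -[LHS]/(g (a - b)) rmorphB /= gab subrr.
- by move=> r; apply: (place_horner r iS_place).
- exact: F_alg.
(* A constant has itself as value and values are unique, so [j] fixes constants. *)
exists j => c; exact: (place_fun iS_place (jS _) (S_cst c)).
Qed.

(** * Irreducible polynomials and Gauss's lemma *)

(** Serves the degree minimisations below, whose properties are not decidable. *)
Lemma ex_least (P : nat -> Prop) :
  (exists n, P n) -> exists2 n, P n & forall m, P m -> (n <= m)%N.
Proof.
move=> exP; have exP' : exists n, `[< P n >].
  by case: exP => n Pn; exists n; apply/asboolP.
case: (ex_minnP exP') => n /asboolP Pn n_min; exists n => // m Pm.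
by apply: n_min; apply/asboolP.
Qed.

(** A nonconstant divisor of least size is irreducible. *)
Lemma irredp_factor (k : fieldType) (c : {poly k}) :
  (1 < size c)%N -> exists2 p, irreducible_poly p & p %| c.
Proof.
move=> c_gt1.
have [|n [p [pn p_gt1 pc]] n_min] := @ex_least (fun n => exists p : {poly k},
    [/\ size p = n, (1 < size p)%N & p %| c]); first by exists (size c), c.
have c0 : c != 0 by rewrite -size_poly_gt0 ltnW.
exists p => //; split=> // q q1 qp.
rewrite -dvdp_size_eqp // eqn_leq dvdp_leq //=; last first.
  by rewrite -size_poly_gt0 ltnW.
rewrite pn; apply: n_min; exists q; split=> //; last exact: dvdp_trans qp pc.
rewrite ltn_neqAle eq_sym q1 size_poly_gt0.
by apply: contraTneq (dvdp_trans qp pc) => ->; rewrite dvd0p.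
Qed.

Lemma irredp_dvdpM (k : fieldType) (p a b : {poly k}) :
  irreducible_poly p -> p %| a * b -> p %| a \/ p %| b.
Proof.
move=> p_irr pab; case: (boolP (p %| a)) => [|pa]; [by left|right].
by rewrite -(Gauss_dvdpr _ (_ : coprimep p a)) // irreducible_poly_coprime.
Qed.

(** Gauss's lemma. If [i] and [j] are the first indices at which [p] fails to divide [Q] and [R],
    then in the coefficient of index [i + j] every product but one has a factor of smaller index,
    hence a factor divisible by [p]. *)
Lemma irredp_dvd_coefM (k : fieldType) (p : {poly k}) (Q R : {poly {poly k}}) :
  irreducible_poly p -> (forall i, p %| (Q * R)`_i) ->
  (forall i, p %| Q`_i) \/ (forall i, p %| R`_i).
Proof.
move=> p_irr pQR; apply: contrapT => /not_orP[/existsNP exQ /existsNP exR].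
have [i /negP pi i_min] := ex_least exQ; have [j /negP pj j_min] := ex_least exR.
have := pQR (i + j)%N; rewrite coefM.
have i_lt : (i < (i + j).+1)%N by rewrite ltnS leq_addr.
rewrite (bigD1 (Ordinal i_lt)) //= addKn dvdp_addl.
  by case/(irredp_dvdpM p_irr) => pij; [move: pi|move: pj]; rewrite pij.
apply: (big_ind (fun u => p %| u)) => [|u u'|l li]; [exact: dvdp0|exact: dvdp_add|].
have [l_lt|l_ge] := ltnP l i.
  by apply: dvdp_mulr; apply: contrapT => nd; have := i_min _ nd; rewrite leqNgt l_lt.
apply: dvdp_mull; apply: contrapT => nd.
have := j_min _ nd; rewrite leqNgt => /negP; apply.
have l_gt : (i < l)%N.
  by rewrite ltn_neqAle l_ge andbT eq_sym; apply: contra_neq li => li; apply: val_inj.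
by rewrite ltn_subLR ?ltn_add2r // -ltnS.
Qed.

Lemma poly_coef_dvd (k : fieldType) (p : {poly k}) (R : {poly {poly k}}) :
  (forall i, p %| R`_i) -> exists R', R = p *: R'.
Proof.
move=> pR; exists (\poly_(i < size R) (R`_i %/ p)); apply/polyP => i.
rewrite coefZ coef_poly; case: ltnP => [_|/(nth_default 0) ->]; last by rewrite mulr0.
by rewrite mulrC divpK.
Qed.

(** The irreducible factors of [c] are cancelled one at a time: each divides all coefficients of
    [Q * R], hence those of [R], because the first hypothesis makes [Q] primitive. *)
Lemma primitive_dvd (k : fieldType) (c : {poly k}) (W Q R : {poly {poly k}}) :
  (forall p, irreducible_poly p -> ~ forall i, p %| Q`_i) ->
  c != 0 -> c *: W = Q * R -> exists R', W = Q * R'.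
Proof.
move=> Q_prim; have [n] := ubnP (size c); elim: n c R => // n IHn c R /ltnSE-le_n c0 E.
have [c_gt1|c_le1] := ltnP 1 (size c); last first.
  have /size_poly1P[l l0 cE] : size c == 1 by rewrite eqn_leq c_le1 size_poly_gt0.
  exists (l^-1%:P *: R); rewrite -scalerAr -E cE scalerA -polyCM mulVf // polyC1.
  by rewrite scale1r.
have [p p_irr /dvdpP[c' cE]] := irredp_factor c_gt1.
have p0 : p != 0 by apply: irredp_neq0.
have c'0 : c' != 0 by apply: contra_neq c0 => c'0; rewrite cE c'0 mul0r.
have pQR i : p %| (Q * R)`_i by rewrite -E coefZ cE mulrAC dvdp_mull.
have [/(Q_prim _ p_irr)//|/poly_coef_dvd[R1 R1E]] := irredp_dvd_coefM p_irr pQR.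
apply: (IHn c' R1) => //.
  apply: leq_trans le_n; rewrite cE size_mul // -subn1 ltn_subRL addnC ltn_add2l.
  by case: p_irr.
have pP0 : p%:P != 0 :> {poly {poly k}} by rewrite polyC_eq0.
by apply: (mulfI pP0); rewrite !mul_polyC scalerA mulrC -cE E R1E -scalerAr.
Qed.

Lemma clear_denominators (A : idomainType) (p : {poly {fraction A}}) :
  exists (s : A) (Q : {poly A}), s != 0 /\ map_poly (@tofrac A) Q = tofrac s *: p.
Proof.
elim/poly_ind: p => [|p c [s [Q [s0 QE]]]].
  by exists 1, 0; rewrite oner_neq0 rmorph0 scaler0.
have [a [b [b0 ->]]] := fracP c.
exists (b * s), (b *: (Q * 'X) + (s * a)%:P); split; first by rewrite mulf_neq0.
rewrite rmorphD /= map_polyZ rmorphM /= map_polyX map_polyC /= QE.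
rewrite scalerDr -scalerAl scalerA -tofracM; congr (_ + _).
rewrite -[in RHS]mul_polyC -polyCM !tofracM; congr _%:P.
by rewrite [tofrac b * _]mulrC -mulrA [tofrac b * _]mulrC divfK ?tofrac_eq0.
Qed.

(** * Subfields of k(T) *)

Section Luroth.
Variables (k F : fieldType) (iota : {rmorphism k -> F}).
Variable j : {rmorphism F -> {fraction {poly k}}}.
Hypothesis j_iota : forall c, j (iota c) = tofrac c%:P.

(** With T standing for [tofrac 'X] and [F] seen inside k(T) through [j], the kernel of [ev] is
    generated by the minimal polynomial of T once [F] is larger than k. *)
Let ev (A : {poly F}) : {fraction {poly k}} := (map_poly j A).[tofrac 'X].

Let evB A B : ev (A - B) = ev A - ev B.
Proof. by rewrite /ev rmorphB !hornerE. Qed.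

Let evM A B : ev (A * B) = ev A * ev B.
Proof. by rewrite /ev rmorphM !hornerE. Qed.

Let evZ a A : ev (a *: A) = j a * ev A.
Proof. by rewrite /ev map_polyZ !hornerE. Qed.

Let map_j_iota (p : {poly k}) :
  map_poly j (map_poly iota p) = map_poly (@tofrac _) (map_poly polyC p).
Proof. by apply/polyP => i; rewrite !coef_map /= j_iota. Qed.

Let ev_iota (p : {poly k}) : ev (map_poly iota p) = tofrac p.
Proof. by rewrite /ev map_j_iota horner_map -/(comp_poly _ _) comp_polyXr. Qed.

Definition nonconstant (v : F) := forall c, v <> iota c.

Lemma nonconstant_independent (v : F) (f g : {poly k}) :
  nonconstant v -> j v = tofrac f / tofrac g -> g != 0 ->
  forall c, f <> c *: g.
Proof.
move=> v_nc vE g0 c fE; apply: (v_nc c); apply: (fmorph_inj j); rewrite vE j_iota fE.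
by rewrite -mul_polyC tofracM mulfK // tofrac_eq0.
Qed.

(** Comparing coefficients at the degree of [g] would make [v] a quotient of constants. *)
Lemma nonconstant_pencil_neq0 (v : F) (f g : {poly k}) :
  nonconstant v -> g != 0 -> map_poly iota f - v *: map_poly iota g != 0.
Proof.
move=> v_nc g0; apply/eqP => /eqP; rewrite subr_eq0 => /eqP /polyP /(_ (size g).-1).
rewrite coefZ !coef_map /= -lead_coefE => E.
have lg0 : iota (lead_coef g) != 0 by rewrite fmorph_eq0 lead_coef_eq0.
by apply: (v_nc (f`_(size g).-1 / lead_coef g)); rewrite fmorph_div E mulfK.
Qed.

Lemma nonconstant_transc (v : F) (c : {poly k}) :
  nonconstant v -> c != 0 -> (map_poly iota c).[v] != 0.
Proof.
move=> v_nc c0; apply/eqP => cv0.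
have [|l lE] := @frac_poly_transc k (j v) c c0.
  rewrite -(rmorph0 j) -cv0 -horner_map; congr (_.[_]).
  by apply/polyP => i; rewrite !coef_map /= j_iota.
by apply: (v_nc l); apply: (fmorph_inj j); rewrite j_iota.
Qed.

(** T is algebraic over [F], as a root of [f - v g] for any nonconstant v = f/g; by Euclidean
    division, an annihilator of least size divides all others. *)
Lemma ex_minpoly : (exists v, nonconstant v) ->
  exists P : {poly F}, [/\ P != 0, ev P = 0 & forall A, ev A = 0 -> P %| A].
Proof.
move=> [v v_nc]; have [f [g [g0 vE]]] := fracP (j v).
have [|n [P [PE P0 Pev]] n_min] := @ex_least (fun n => exists P : {poly F},
    [/\ size P = n, P != 0 & ev P = 0]).
  pose D := map_poly iota f - v *: map_poly iota g; exists (size D), D.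
  split=> //; last by rewrite evB evZ !ev_iota vE mulfVK ?subrr ?tofrac_eq0.
  exact: nonconstant_pencil_neq0.
exists P; split=> // A A0; apply: contrapT => /negP PA.
have AE : A %% P = A - A %/ P * P by apply/esym/(canLR (addrK _)); rewrite addrC -divp_eq.
have : (n <= size (A %% P)%R)%N.
  apply: n_min; exists (A %% P); split=> //.
  by rewrite AE evB evM A0 Pev mulr0 subr0.
by rewrite leqNgt -PE ltn_modp P0.
Qed.

(** These combinations are the coefficients of the powers of T in W. Since [f] and [g] are
    independent over k, two of them already span both. *)
Lemma pencil_common_divisor (v : F) (f g r : {poly k}) :
  nonconstant v -> g != 0 -> j v = tofrac f / tofrac g ->
  (forall i, r %| g`_i *: f - f`_i *: g) -> r %| f /\ r %| g.
Proof.
move=> v_nc g0 vE r_dvd.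
have lg0 : lead_coef g != 0 by rewrite lead_coef_eq0.
pose c := f`_(size g).-1 / lead_coef g.
have ru : r %| f - c *: g.
  have := r_dvd (size g).-1; rewrite -lead_coefE.
  have -> : lead_coef g *: f - f`_(size g).-1 *: g = lead_coef g *: (f - c *: g).
    by rewrite scalerBr scalerA mulrC divfK.
  by rewrite dvdpZr.
have /eqP := @nonconstant_independent v f g v_nc vE g0 c.
(* [i] is the degree of [f - c *: g], so the combination at [i] is not proportional to the one at
   the degree of [g]. *)
rewrite -subr_eq0 -lead_coef_eq0 lead_coefE; set i := _.-1.
rewrite coefB coefZ => fi.
have rg : r %| g.
  rewrite -(dvdpZr _ _ fi).
  have -> : (f`_i - c * g`_i) *: g = g`_i *: (f - c *: g) - (g`_i *: f - f`_i *: g).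
    by rewrite scalerBr scalerA scalerBl [g`_i * c]mulrC opprB [RHS]addrC addrA subrK.
  by rewrite dvdp_sub // -mul_polyC dvdp_mull.
by split=> //; rewrite -(subrK (c *: g) f) dvdp_add // -mul_polyC dvdp_mull.
Qed.

(** Primitivity will let divisibility over k(T) descend to k[T]. *)
Lemma minpoly_model (P : {poly F}) : P != 0 ->
  exists (Q : {poly {poly k}}) (c : {fraction {poly k}}),
    [/\ c != 0, map_poly (@tofrac _) Q = c *: map_poly j P
      & forall p, irreducible_poly p -> ~ forall i, p %| Q`_i].
Proof.
move=> P0.
(* A common factor of the coefficients of [Q] divides its leading coefficient,
   so minimising the degree of the latter makes [Q] primitive. *)
have [|n [Q [c [QE c0 cE]]] n_min] := @ex_least (fun n =>
    exists (Q : {poly {poly k}}) (c : {fraction {poly k}}),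
    [/\ size (lead_coef Q : {poly k}) = n, c != 0
      & map_poly (@tofrac {poly k}) Q = c *: map_poly j P]).
  have [s [Q [s0 QE]]] := clear_denominators (map_poly j P).
  by exists (size (lead_coef Q)), Q, (tofrac s); rewrite tofrac_eq0.
exists Q, c; split=> // p p_irr /poly_coef_dvd[Q' Q'E].
have p0 : p != 0 by apply: irredp_neq0.
have Q0 : Q != 0.
  apply: contra_neq P0 => Q0; apply/eqP; rewrite -(map_poly_eq0 j).
  by move/esym/eqP: cE; rewrite Q0 rmorph0 scaler_eq0 (negPf c0).
have Q'0 : Q' != 0 by apply: contra_neq Q0 => Q'0; rewrite Q'E Q'0 scaler0.
have : (n <= size (lead_coef Q'))%N.
  have tp0 : tofrac p != 0 by rewrite tofrac_eq0.
  apply: n_min; exists Q', (c / tofrac p); split; first exact: erefl.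
    exact: mulf_neq0 c0 (invr_neq0 tp0).
  by rewrite mulrC -scalerA -cE Q'E map_polyZ scalerA mulVf // scale1r.
rewrite -QE Q'E -mul_polyC lead_coefM lead_coefC size_mul ?lead_coef_eq0 //.
have [p_gt1 _] := p_irr.
by rewrite leqNgt -subn1 ltn_subRL ltn_add2r p_gt1.
Qed.

(** The minimal polynomial [P] divides [D], so equality of sizes is enough. Sizes are compared in
    k[T][Y], where [Q] and [W] are multiples of the images of [P] and [D]. *)
Lemma luroth_divisor (v : F) (f g : {poly k}) :
  nonconstant v -> g != 0 -> j v = tofrac f / tofrac g ->
  (forall v' f' g', nonconstant v' -> g' != 0 -> j v' = tofrac f' / tofrac g' ->
     (maxn (size f) (size g) <= maxn (size f') (size g'))%N) ->
  forall A, ev A = 0 -> map_poly iota f - v *: map_poly iota g %| A.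
Proof.
move=> v_nc g0 vE fg_min.
have [|P [P0 Pev P_dvd]] := ex_minpoly; first by exists v.
set D := map_poly iota f - v *: map_poly iota g.
have tg0 : tofrac g != 0 by rewrite tofrac_eq0.
have D0 : D != 0 by apply: nonconstant_pencil_neq0.
have PdvdD : P %| D by apply: P_dvd; rewrite evB evZ !ev_iota vE mulfVK ?subrr.
suff PD : size P = size D.
  have PD' : P %= D by rewrite -dvdp_size_eqp // PD.
  by move=> A /P_dvd; rewrite (eqp_dvdl _ PD').
have [Q [c [c0 QE Q_prim]]] := minpoly_model P0.
have Q0 : Q != 0.
  apply: contra_neq P0 => Q0; apply/eqP; rewrite -(map_poly_eq0 j).
  by move/esym/eqP: QE; rewrite Q0 rmorph0 scaler_eq0 (negPf c0).
have lP0 : lead_coef P != 0 by rewrite lead_coef_eq0.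
have size_QP : size Q = size P.
  rewrite -(size_map_poly j) -(size_scale _ c0) -QE size_map_inj_poly ?tofrac0 //.
  exact: tofrac_inj.
have coef_P i : j (P`_i / lead_coef P) = tofrac Q`_i / tofrac (lead_coef Q).
  have QiE l : tofrac Q`_l = c * j P`_l.
    by have := congr1 (fun p : {poly _} => p`_l) QE; rewrite /= coefZ !coef_map.
  by rewrite fmorph_div [lead_coef Q]lead_coefE size_QP !QiE -mulf_div divff ?mul1r.
(* If all coefficients of the monic minimal polynomial were constants, T would be algebraic over k.
   A nonconstant one is a quotient of two coefficients of [Q], so minimality of [v] bounds the
   T-degree of [Q] from below; [sizeY] is the T-degree plus one. *)
have Q_high : (maxn (size f) (size g) <= sizeY Q)%N.
  have [i ni] : exists i, nonconstant (P`_i / lead_coef P).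
    apply: contrapT => /forallNP nc.
    have /choice[u uE] i : exists l, P`_i / lead_coef P = iota l.
      by apply: contrapT => ni; apply: (nc i) => l li; apply: ni; exists l.
    pose p := \poly_(i < size P) u i.
    have PE : P = lead_coef P *: map_poly iota p.
      apply/polyP => i; rewrite coefZ coef_map coef_poly /=.
      case: ltnP => [_|/(nth_default 0) ->]; last by rewrite rmorph0 mulr0.
      by rewrite -uE mulrC divfK.
    move/eqP: Pev; rewrite PE evZ ev_iota mulf_eq0 fmorph_eq0 (negPf lP0) tofrac_eq0.
    by move=> /eqP p0; case/eqP: P0; rewrite PE p0 rmorph0 scaler0.
  apply: leq_trans (fg_min _ _ _ ni _ (coef_P i)) _; first by rewrite lead_coef_eq0.
  by rewrite geq_max max_size_coefXY max_size_lead_coefXY.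
(* The outer variable is Y and the coefficients are polynomials in T. *)
pose W : {poly {poly k}} := g *: f^:P - f *: g^:P.
have WE : map_poly (@tofrac _) W = tofrac g *: map_poly j D.
  rewrite rmorphB /= !map_polyZ /D rmorphB /= map_polyZ !map_j_iota scalerBr scalerA vE.
  have gf : tofrac g * (tofrac f / tofrac g) = tofrac f.
    rewrite mulrC.
    exact: (divfK tg0).
  rewrite gf.
  exact: erefl.
(* Over k(T), [D] is a multiple of [P]; clearing denominators gives [a *: W = Q * (b *: R)] over
   k[T], and primitivity of [Q] removes [a]. *)
have [R WQR] : exists R, W = Q * R.
  have /dvdpP[S DE] := PdvdD.
  have [s [R [s0 RE]]] := clear_denominators (map_poly j S).
  have [a [b [b0 abE]]] := fracP (c * tofrac s / tofrac g).
  have ts0 : tofrac s != 0 by rewrite tofrac_eq0.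
  have tb0 : tofrac b != 0 by rewrite tofrac_eq0.
  have a0 : a != 0.
    apply: contraNneq (mulf_neq0 (mulf_neq0 c0 ts0) (invr_neq0 tg0)) => a0.
    by rewrite abE a0 tofrac0 mul0r.
  apply: (primitive_dvd Q_prim a0 (R := b *: R)).
  apply: (map_inj_poly (@tofrac_inj _) (tofrac0 _)).
  rewrite rmorphM /= !map_polyZ /= WE QE RE DE rmorphM /=.
  rewrite -scalerAr -!scalerAl -scalerAr !scalerA [map_poly j S * _]mulrC; congr (_ *: _).
  have -> : tofrac a = c * tofrac s / tofrac g * tofrac b by rewrite abE divfK.
  by rewrite mulrAC (divfK tg0) [tofrac b * c]mulrC [RHS]mulrAC.
have W0 : W != 0.
  apply: contra_neq D0 => W0; apply/eqP; rewrite -(map_poly_eq0 j).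
  by move/esym/eqP: WE; rewrite W0 rmorph0 scaler_eq0 (negPf tg0).
have R0 : R != 0 by apply: contra_neq W0 => R0; rewrite WQR R0 mulr0.
have W_low : (sizeY W <= maxn (size f) (size g))%N.
  apply/bigmax_leqP => i _; rewrite coefB !coefZ !coef_map /=.
  apply: leq_trans (size_polyD _ _) _; rewrite size_polyN ![_ * _%:P]mulrC !mul_polyC.
  rewrite geq_max !leq_max.
  by rewrite !size_scale_leq orbT.
(* T-degrees add up in [W = Q * R], so [R] has T-degree 0: it is a polynomial [r] in Y alone. *)
have [r r0 RE] : exists2 r, r != 0 & swapXY R = r%:P.
  have sQ0 : swapXY Q != 0 by rewrite swapXY_eq0.
  have sR0 : swapXY R != 0 by rewrite swapXY_eq0.
  have : (size (swapXY R) <= 1)%N.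
    have := leq_trans W_low Q_high.
    rewrite !sizeYE WQR rmorphM size_mul // => le.
    move: le; rewrite -(prednK (_ : 0 < size (swapXY Q))%N) ?size_poly_gt0 // addSn /=.
    by rewrite -addn1 leq_add2l.
  move=> /size1_polyC RE; exists (swapXY R)`_0 => //.
  by rewrite -polyC_eq0 -RE.
have r_dvd i : r %| g`_i *: f - f`_i *: g.
  have := congr1 swapXY WQR; rewrite rmorphM /= RE => /polyP /(_ i).
  rewrite coefMC => WiE.
  have <- : (swapXY W)`_i = g`_i *: f - f`_i *: g.
    apply/polyP => l; rewrite coef_swapXY !coefB !coefZ !coef_map /= !coefMC.
    by [].
  by rewrite WiE dvdp_mull.
have [/dvdpP[f1 fE] /dvdpP[g1 gE]] := pencil_common_divisor v_nc g0 vE r_dvd.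
have f0 : f != 0.
  apply/eqP => f0; apply: (nonconstant_independent v_nc vE g0 (c := 0)).
  by rewrite scale0r.
have f10 : f1 != 0 by apply: contra_neq f0 => f10; rewrite fE f10 mul0r.
have g10 : g1 != 0 by apply: contra_neq g0 => g10; rewrite gE g10 mul0r.
(* Otherwise [f1] and [g1] would represent the same [v] with smaller sizes. *)
have r1 : size r = 1%N.
  apply/eqP; rewrite eqn_leq size_poly_gt0 r0 andbT leqNgt; apply/negP => r_gt1.
  have tr0 : tofrac r != 0 by rewrite tofrac_eq0.
  have := fg_min v f1 g1 v_nc g10; rewrite vE fE gE !tofracM -mulf_div divff // mulr1.
  move/(_ erefl); rewrite leqNgt gtn_max !leq_max !size_mul //.
  have lt_size u : (u < (u + size r).-1)%N by rewrite -subn1 ltn_subRL addnC ltn_add2l.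
  by rewrite !lt_size orbT.
have R1 : size R = 1%N.
  by rewrite -(swapXYK R) RE swapXY_polyC size_map_polyC.
have -> : size D = size W.
  rewrite -(size_map_poly j) -(size_scale _ tg0) -WE size_map_inj_poly ?tofrac0 //.
  exact: tofrac_inj.
by rewrite -size_QP WQR size_mul // R1 addn1.
Qed.

(** The least size is taken over the representations f/g as well as over the elements [v], which
    forces the chosen fraction into lowest terms. *)
Lemma luroth_generator : (exists v, nonconstant v) ->
  exists v, forall y, exists a b : {poly k},
    (map_poly iota b).[v] != 0 /\ y = (map_poly iota a).[v] / (map_poly iota b).[v].
Proof.
move=> exv.
have [|m [v [f [g [v_nc g0 vE mE]]]] m_min] := @ex_least (fun m => exists v f g,
    [/\ nonconstant v, g != 0, j v = tofrac f / tofrac g & maxn (size f) (size g) = m]).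
  have [v v_nc] := exv; have [f [g [g0 vE]]] := fracP (j v).
  by exists (maxn (size f) (size g)), v, f, g.
set D := map_poly iota f - v *: map_poly iota g.
have D_dvd A : ev A = 0 -> D %| A.
  apply: (luroth_divisor v_nc g0 vE) => v' f' g' v'_nc g'0 v'E.
  by rewrite mE; apply: m_min; exists v', f', g'.
pose e : {rmorphism {poly k} -> F} := horner_morph (fun x => mulrC v (iota x)).
have eE c : e c = (map_poly iota c).[v] by [].
(* [E] maps k(T) onto k(v), sending T to [v]. Below, [D] is the image of [D0], so remainders modulo
   [D] have coefficients in k(v). *)
have [|E EE] := @frac_lift {poly k} F e.
  move=> a b ab; apply/eqP; rewrite -subr_eq0.
  apply: contraT => /(nonconstant_transc v_nc).
  by rewrite -eE rmorphB ab subrr eqxx.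
pose cst : {rmorphism k -> {fraction {poly k}}} := @tofrac {poly k} \o polyC.
have map_E p : map_poly E (map_poly cst p) = map_poly iota p.
  by apply/polyP => i; rewrite !coef_map /= EE eE map_polyC hornerC.
pose D0 := map_poly cst f - tofrac 'X *: map_poly cst g.
have DE : map_poly E D0 = D.
  by rewrite rmorphB /= map_polyZ !map_E /= EE eE map_polyX hornerX.
exists v => y; have [a [b [b0 yE]]] := fracP (j y).
pose a0 := map_poly cst a %% D0; pose b0' := map_poly cst b %% D0.
have a0E : map_poly E a0 = map_poly iota a %% D by rewrite map_modp DE map_E.
have b0E : map_poly E b0' = map_poly iota b %% D by rewrite map_modp DE map_E.
(* The polynomial a - y b vanishes at T, hence is a multiple of [D], and its remainder is zero. *)
have abE : map_poly E a0 = y *: map_poly E b0'.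
  apply/eqP; rewrite -subr_eq0 a0E b0E -modpZl -modpN -modpD; apply/eqP/modp_eq0P/D_dvd.
  by rewrite evB evZ !ev_iota yE mulfVK ?subrr ?tofrac_eq0.
(* Otherwise [D] would divide [b], and evaluating at T would give b = 0. *)
have : b0' != 0.
  rewrite -(map_poly_eq0 E) b0E; apply: contraNneq b0 => /modp_eq0P /dvdpP[q qE].
  rewrite -tofrac_eq0 -ev_iota qE evM.
  have -> : ev D = 0 by rewrite evB evZ !ev_iota vE mulfVK ?subrr ?tofrac_eq0.
  by rewrite mulr0.
rewrite -lead_coef_eq0; set i := lead_coef b0' => bi0.
(* [y] is the ratio of the coefficients of the two remainders at the leading position of [b0']. *)
have [c [d [d0 cdE]]] := fracP (a0`_(size b0').-1 / i).
have Ed0 : e d != 0 by apply: nonconstant_transc.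
exists c, d; split=> //; rewrite -!eE -!EE -fmorph_div -cdE fmorph_div -coef_map abE.
by rewrite coefZ coef_map mulfK // fmorph_eq0.
Qed.

End Luroth.

(** * Intermediate fields of k(x) and the generator of K *)

Lemma intermediate_field_horner (k L : fieldType) (iota : {rmorphism k -> L})
    (M : set L) (v : L) (a b : {poly k}) :
  intermediate_field iota M -> M v ->
  M ((map_poly iota a).[v] / (map_poly iota b).[v]).
Proof.
move=> [iM M_div] Mv.
pose S : divringClosed L := HB.pack (mem M : {pred L})
  (GRing.isDivringClosed.Build L (mem M) M_div).
have SE y : y \in S = (y \in M) by [].
have hS (p : {poly k}) : (map_poly iota p).[v] \in S.
  apply: rpred_horner; last by rewrite SE inE.
  by apply/polyOverP => i; rewrite SE inE coef_map; apply: iM; exists p`_i.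
by have : (map_poly iota a).[v] / (map_poly iota b).[v] \in S;
  [rewrite rpred_div|rewrite SE inE].
Qed.

Lemma range_intermediate_field (k L E : fieldType) (iota : {rmorphism k -> L})
    (h : {rmorphism E -> L}) :
  (forall c, exists x, iota c = h x) -> intermediate_field iota (range h).
Proof.
move=> ih; split; first by move=> _ [c _ <-]; have [x ->] := ih c; exists x.
split=> [|x y|x y]; rewrite ?inE.
- by exists 1 => //; rewrite rmorph1.
- by move=> [a _ <-] [b _ <-]; exists (a - b) => //; rewrite rmorphB.
- by move=> [a _ <-] [b _ <-]; exists (a / b) => //; rewrite fmorph_div.
Qed.

Lemma alg_independent_transc (k L : fieldType) (iota : {rmorphism k -> L})
    (t : 'I_1 -> L) (c : {poly k}) :
  alg_independent iota t -> c != 0 -> (map_poly iota c).[t ord0] != 0.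
Proof.
move=> t_ind; apply: contra_neq => ct0.
pose p : {mpoly k[1]} := (map_poly (@mpolyC 1 k) c).['X_ord0].
have pE (B : comNzRingType) (f : {rmorphism k -> B}) (h : 'I_1 -> B) :
    mmap f h p = (map_poly f c).[h ord0].
  rewrite -[LHS](horner_map (mmap f h)) /= mmapX mmap1U -map_poly_comp /=; congr (_.[_]).
  by apply: eq_map_poly => a /=; rewrite mmapC.
have p0 : p = 0 by apply: t_ind; rewrite pE.
(* Substituting ['X] for the only variable of [p] gives [c] back. *)
by have := pE _ polyC (fun=> 'X); rewrite p0 mmap0 -/(comp_poly _ _) comp_polyXr.
Qed.

(** Elements of k(t) lift to fractions of polynomials, whose denominators are cleared. As [w] is
    nonzero, the largest power of the variable dividing the equation can be removed, leaving a
    nonzero constant coefficient. *)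
Lemma algebraic_over_transc (k L : fieldType) (iota : {rmorphism k -> L})
    (T : set L) (t w : L) :
  T `<=` [set t] ->
  (forall c : {poly k}, c != 0 -> (map_poly iota c).[t] != 0) ->
  algebraic_over (adjoin iota T) w -> w != 0 ->
  exists P : {poly {poly k}},
    P`_0 != 0 /\ (map_poly (fun c => (map_poly iota c).[t]) P).[w] = 0.
Proof.
move=> Tt t_transc [p [p0 p_over /rootP pw]] w0.
pose e : {rmorphism {poly k} -> L} := horner_morph (fun x => mulrC t (iota x)).
have e0 c : e c = 0 -> c = 0 by apply: contra_eq => /t_transc.
have [|E EE] := @frac_lift {poly k} L e.
  move=> a b ab; apply/eqP; rewrite -subr_eq0; apply/eqP/e0.
  by rewrite rmorphB ab subrr.
(* By minimality of [adjoin], it suffices that the range of [E] is an intermediate field containing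
   [t]. *)
have adj_E : adjoin iota T `<=` range E.
  apply: smallest_sub.
    apply: range_intermediate_field => c; exists (tofrac c%:P).
    by rewrite EE /= /horner_morph map_polyC hornerC.
  move=> _ /Tt ->; exists (tofrac 'X) => //.
  by rewrite EE /= /horner_morph map_polyX hornerX.
have /choice[u uE] i : exists x, E x = p`_i.
  have [lt_ip|/(nth_default 0) ->] := ltnP i (size p); last by exists 0; rewrite rmorph0.
  have /allP/(_ _ (mem_nth 0 lt_ip)) := p_over.
  by rewrite /= in_setE => /adj_E[x _ xE]; exists x.
pose p' := \poly_(i < size p) u i.
have pE : p = map_poly E p'.
  apply/polyP => i; rewrite coef_map coef_poly /=.
  by case: ltnP => [_|/(nth_default 0) ->]; rewrite ?uE ?rmorph0.
have [s [Q [s0 QE]]] := clear_denominators p'.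
have Qe : map_poly e Q = e s *: p.
  rewrite pE -EE -map_polyZ -QE; apply/polyP => i.
  by rewrite !coef_map /= EE.
have Q0 : Q != 0.
  apply: contra_neq p0 => Q0; apply/eqP; move/esym/eqP: Qe.
  by rewrite Q0 rmorph0 scaler_eq0 => /orP[/eqP/e0/eqP|//]; rewrite (negPf s0).
have [n [P Pr QP]] := multiplicity_XsubC Q 0.
exists P; split.
  by move: Pr; rewrite Q0 /root horner_coef0.
apply: (mulIf (expf_neq0 n w0)); rewrite mul0r.
rewrite -[RHS](mulr0 (e s)) -pw -hornerZ -Qe QP rmorphM /= rmorphXn /= subr0.
by rewrite map_polyX hornerM hornerXn.
Qed.

Theorem theorem2 (k : fieldType) (n : nat) (n_ge1 : (1 <= n)%N)
    (K : set (ratfun k n))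
    (K_field : intermediate_field (ratfun_const k n) K)
    (K_trdeg1 : has_trdeg (ratfun_const k n) K 1) :
  exists v : ratfun k n, K = adjoin (ratfun_const k n) [set v]%classic.
Proof.
have [iK K_div] := K_field; have [t [tK t_ind K_alg]] := K_trdeg1.
(* From here on K is the field type [F], embedded by [i]; constants and [t] are pulled back to
   it. *)
have [F [i i_mem]] := divring_closed_subfield K_div.
have iP y : K y -> exists x, y = i x by move=> Ky; apply/i_mem; rewrite inE.
have [|iota iotaE] := @sub_field_morph _ _ _ (ratfun_const k n) i.
  by move=> c; apply: iP; apply: iK; exists c.
have [|t0 t0E] := iP (t ord0); first by apply: tK; exists ord0.
have i_horner (c : {poly k}) x :
    i (map_poly iota c).[x] = (map_poly (ratfun_const k n) c).[i x].
  rewrite -horner_map -map_poly_comp; congr (_.[_]).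
  by apply: eq_map_poly => a /=; rewrite iotaE.
have t_transc c : c != 0 -> (map_poly iota c).[t0] != 0.
  move=> c0; rewrite -(fmorph_eq0 i) i_horner -t0E.
  exact: alg_independent_transc t_ind c0.
have F_alg w : w != 0 -> exists P : {poly {poly k}},
    P`_0 != 0 /\ (map_poly (fun c => (map_poly iota c).[t0]) P).[w] = 0.
  move=> w0.
  have [||||P [P0 Pw]] :=
    @algebraic_over_transc _ _ (ratfun_const k n) (range t) (i t0) (i w).
  - by move=> _ [u _ <-]; rewrite -t0E [u]ord1.
  - by move=> c c0; rewrite -i_horner fmorph_eq0 t_transc.
  - by apply: K_alg; have /i_mem : exists x, i w = i x by [exists w]; rewrite inE.
  - by rewrite fmorph_eq0.
  exists P; split=> //; apply: (fmorph_inj i); rewrite rmorph0 -Pw -horner_map.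
  congr (_.[_]); apply/polyP => l; rewrite coef_map !coef_map_id0.
  - exact: i_horner.
  - by rewrite rmorph0 horner0.
  - by rewrite rmorph0 horner0.
have [j jE] := trdeg1_embedding iotaE t_transc F_alg.
have [|v vE] := luroth_generator jE.
  exists t0 => c t0c; have := t_transc ('X - c%:P).
  rewrite polyXsubC_eq0 rmorphB /= map_polyX map_polyC hornerXsubC t0c subrr eqxx.
  by move/(_ isT).
have Kv : K (i v) by have /i_mem : exists x, i v = i x by [exists v]; rewrite inE.
(* The adjoined field lies in K by minimality; conversely, each element of K is a quotient of
   polynomial values at [i v], which every intermediate field [M] containing [i v] contains. *)
exists (i v); apply/seteqP; split=> [y /iP[x ->]|]; last first.
  by apply: smallest_sub => // _ ->.
move=> M [M_field Mv]; have [a [b [b0 ->]]] := vE x.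
by rewrite fmorph_div !i_horner; apply: intermediate_field_horner => //; apply: Mv.
Qed.
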